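(* For every integer $n\geq 2$, \[ \mathrm{Ht}(\mathrm{RCong}(\mathcal T_n)) = 1+\sum_{r=1}^n S(n,r)\, \mathrm{Ht}(\mathrm{Sub}(\mathcal S_r)), \] where $S(n,r)$ is the Stirling number of the second kind.
   Context: The height $\mathrm{Ht}(P)$ of a poset $P$ is the supremum of the cardinalities (numbers of elements) of chains in $P$. $\mathcal T_n$ is the full transformation monoid: all maps $\{1,\dots,n\}\to\{1,\dots,n\}$, with maps written to the right of their arguments and composed from left to right, i.e. $x(\alpha\beta)=(x\alpha)\beta$. A right congruence of a semigroup $S$ is an equivalence relation $\sigma$ on $S$ such that $(x,y)\in\sigma$ implies $(xa,ya)\in\sigma$ for all $a,x,y\in S$; $\mathrm{RCong}(S)$ is the lattice of all right congruences of $S$ ordered by inclusion. $\mathcal S_r$ is the symmetric group of degree $r$, and $\mathrm{Sub}(G)$ is the lattice of subgroups of a group $G$ ordered by inclusion. *)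

(* Defs.v *)
From HB Require Import structures.
From mathcomp Require Import all_boot all_order all_fingroup.

Set Implicit Arguments.
Unset Strict Implicit.
Unset Printing Implicit Defensive.

Import Order.Theory.

(* For a finite poset the supremum of the cardinalities of chains is a maximum;
   the number of elements (not of covering steps) of a chain is counted. *)
Definition chain d (P : finPOrderType d) (C : {set P}) : bool :=
  [forall x in C, forall y in C, (x >=< y)%O].

Definition height d (P : finPOrderType d) : nat :=
  \max_(C : {set P} | chain C) #|C|.

Section FullTransformationMonoid.

Variable n : nat.

Local Notation full_transf := {ffun 'I_n -> 'I_n}.

(* Maps act on the right of their arguments: x (a b) = (x a) b. *)
Definition transf_mul (a b : full_transf) : full_transf :=
  [ffun x => b (a x)].

Definition transf_one : full_transf := [ffun x => x].

Lemma transf_mulA : associative transf_mul.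
Proof. by move=> a b c; apply/ffunP=> x; rewrite !ffunE. Qed.

Lemma transf_mul1 : left_id transf_one transf_mul.
Proof. by move=> a; apply/ffunP=> x; rewrite !ffunE. Qed.

Lemma transf_mulr1 : right_id transf_one transf_mul.
Proof. by move=> a; apply/ffunP=> x; rewrite !ffunE. Qed.

HB.instance Definition _ := Monoid.isLaw.Build full_transf transf_one transf_mul
  transf_mulA transf_mul1 transf_mulr1.

End FullTransformationMonoid.

Section RightCongruences.

(* The finite semigroup is the operator mul, associative by its structure: the
   library has no finite semigroup type that is not already a star monoid. *)
Variables (S : finType) (mul : SemiGroup.law S).

Definition right_congruence (R : {set S * S}) : bool :=
  [&& [forall x, (x, x) \in R],
      [forall x, forall y, ((x, y) \in R) ==> ((y, x) \in R)],
      [forall x, forall y, forall z,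
         ((x, y) \in R) && ((y, z) \in R) ==> ((x, z) \in R)]
    & [forall a, forall x, forall y,
         ((x, y) \in R) ==> ((mul x a, mul y a) \in R)]].

Record rcong := RCong {
  rcong_rel :> {set S * S};
  _ : right_congruence rcong_rel
}.

HB.instance Definition _ := [isSub for rcong_rel].
HB.instance Definition _ := [Finite of rcong by <:].

Definition rcong_le (R1 R2 : rcong) : bool := R1 \subset R2.

Lemma rcong_le_refl : reflexive rcong_le.
Proof. by move=> R; apply: subxx. Qed.

Lemma rcong_le_anti : antisymmetric rcong_le.
Proof. by move=> R1 R2 sR; apply/val_inj/eqP; rewrite eqEsubset. Qed.

Lemma rcong_le_trans : transitive rcong_le.
Proof. by move=> R2 R1 R3; apply: subset_trans. Qed.

HB.instance Definition _ := Order.Le_isPOrder.Build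
  Order.SetSubsetOrder.subset_display
  rcong rcong_le_refl rcong_le_anti rcong_le_trans.

End RightCongruences.

Section Subgroups.

Variable gT : finGroupType.

Definition subgroup_lattice : Type := {group gT}.

HB.instance Definition _ := Finite.on subgroup_lattice.

Definition subgroup_le (H K : subgroup_lattice) : bool := H \subset K.

Lemma subgroup_le_refl : reflexive subgroup_le.
Proof. by move=> H; apply: subxx. Qed.

Lemma subgroup_le_anti : antisymmetric subgroup_le.
Proof. by move=> H K sHK; apply/val_inj/eqP; rewrite eqEsubset. Qed.

Lemma subgroup_le_trans : transitive subgroup_le.
Proof. by move=> K H L; apply: subset_trans. Qed.

HB.instance Definition _ := Order.Le_isPOrder.Build
  Order.SetSubsetOrder.subset_display
  subgroup_lattice subgroup_le_refl subgroup_le_anti subgroup_le_trans.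

End Subgroups.

(* The number of partitions of an n-set into r nonempty blocks. *)
Definition stirling2 (n r : nat) : nat :=
  #|[set P : {set {set 'I_n}} | partition P [set: 'I_n] & #|P| == r]|.

(* Main.v *)
Require Import Defs.
From mathcomp Require Import all_boot all_order all_fingroup.

Set Implicit Arguments.
Unset Strict Implicit.
Unset Printing Implicit Defensive.

Import Order.Theory.

(** Let T_n act on itself on the right. The R-classes of T_n are the kernel
    classes, so there are S(n,r) of them of rank r, and [code] lists them so that
    every initial segment of the list is a right ideal. The theorem says that
    along this list the R-classes contribute independently to the height, one of
    rank r contributing Ht(Sub(S_r)) strict steps.

    Upper bound ([height_upper]). Fix for every kernel K a map [rep K] whose image
    is the set of the first r points, so that S_r acts regularly on its H-class.
    A right congruence R leaves two kinds of traces at K: either it is [fused]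
    there, that is, it relates [rep K] to an element of an earlier R-class or of
    another H-class of the same R-class, or it is described at K by the subgroup
    [stab] of those permutations in S_r that move [rep K] within its R-class
    modulo R. Both traces grow with R, and the key lemma [invariants_reflect] says
    that together they detect strict inclusions. When R is not fused at K, a
    related pair with later R-class K lies in one H-class, hence is recorded by
    the subgroup. When R is fused at K, each element of the R-class is related to
    an earlier one, so that the pair can be moved down and induction applies; the
    only exception is the R-class of the constant maps, which has no earlier
    class and is then a single class of R ([fused_cases]). Adding up over K the
    depth of the subgroup in Sub(S_r), or Ht(Sub(S_r)) when R is fused, gives a
    strictly increasing function on the right congruences, with values between 0
    and the sum of all Ht(Sub(S_r)). The length of every chain is bounded
    accordingly.

    Lower bound ([height_lower]). Collapsing an initial segment of the list gives
    the Rees congruence [rees k]. If K is the next R-class, then every subgroup H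
    of S_r defines the congruence [orbit_cong], which in addition identifies the
    H-orbits inside K. It depends strictly monotonically on H and lies between two
    consecutive Rees congruences, strictly below the upper one. So a longest chain
    of subgroups can be inserted for every K ([depth_rees]), with the universal
    congruence on top of everything. *)

(** * Heights and depths in finite posets *)

Section Depth.

Variables (d : Order.disp_t) (P : finPOrderType d).
Implicit Types (x y : P) (C D : {set P}).

Lemma chainP C : reflect {in C &, forall x y, (x >=< y)%O} (chain C).
Proof.
apply: (iffP forall_inP) => [cC x y Cx Cy | cC x Cx].
  by have /forall_inP := cC x Cx; apply.
by apply/forall_inP=> y Cy; apply: cC.
Qed.

Lemma chain_set0 : chain (set0 : {set P}).
Proof. by apply/chainP=> x y; rewrite inE. Qed.

Lemma chain_setU x C D :
    chain C -> {in C, forall z, (z < x)%O} ->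
    chain D -> {in D, forall z, (x <= z)%O} ->
  chain (C :|: D) /\ #|C :|: D| = #|C| + #|D|.
Proof.
move=> /chainP cC ltCx /chainP cD leDx.
have ltCD u v : u \in C -> v \in D -> (u < v)%O.
  by move=> Cu Dv; apply: lt_le_trans (ltCx u Cu) (leDx v Dv).
split.
  apply/chainP=> u v /setUP[Cu|Du] /setUP[Cv|Dv]; [exact: cC | | | exact: cD].
    by apply: le_comparable; apply/ltW/ltCD.
  by rewrite comparable_sym; apply: le_comparable; apply/ltW/ltCD.
apply/eqP; rewrite leq_card_setU; apply/pred0P=> u /=.
by apply/negP=> /andP[Cu Du]; have := ltCD u u Cu Du; rewrite ltxx.
Qed.

Lemma height_witness : exists2 C : {set P}, chain C & #|C| = height P.
Proof.
have [|C cC eqC] := @eq_bigmax_cond _ (@chain d P) (fun C => #|C|).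
  by apply/card_gt0P; exists set0; apply: chain_set0.
by exists C; rewrite // /height eqC.
Qed.

Lemma leq_height C : chain C -> #|C| <= height P.
Proof. exact: (@leq_bigmax_cond _ _ (fun C : {set P} => #|C|)). Qed.

(** Comparing depths avoids manipulating chains as lists: [depth] is a strictly
    increasing numbering of [P] that stays below [height P]. *)
Definition depth x :=
  \max_(C : {set P} | chain C && [forall y in C, (y < x)%O]) #|C|.

Lemma leq_depth x C :
  chain C -> {in C, forall y, (y < x)%O} -> #|C| <= depth x.
Proof.
move=> cC /forall_inP ltCx.
by apply: (@leq_bigmax_cond _ _ (fun C : {set P} => #|C|)); rewrite cC.
Qed.

Lemma depth_witness x :
  exists2 C : {set P}, chain C /\ {in C, forall y, (y < x)%O} & #|C| = depth x.
Proof.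
have [|C] := @eq_bigmax_cond _ [pred C : {set P} |
    chain C && [forall y in C, (y < x)%O]] (fun C => #|C|).
  apply/card_gt0P; exists set0; apply/andP; split; first exact: chain_set0.
  by apply/forall_inP=> y; rewrite inE.
by case/andP=> cC /forall_inP ltCx eqC; exists C; rewrite // /depth eqC.
Qed.

Lemma chain_below_setU1 x :
  exists C : {set P}, [/\ chain C, {in C, forall y, (y <= x)%O}
    & #|C| = (depth x).+1].
Proof.
have [C [cC ltCx] <-] := depth_witness x.
have c1 : chain [set x].
  by apply/chainP=> u v /set1P-> /set1P->; apply: comparablexx.
have [|cU eqU] := chain_setU cC ltCx c1; first by move=> u /set1P->.
exists (C :|: [set x]); split; rewrite ?eqU ?cards1 ?addn1 //.
by move=> u /setUP[/ltCx/ltW|/set1P->].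
Qed.

Lemma depth_lt_height x : depth x < height P.
Proof. by have [C [cC _ <-]] := chain_below_setU1 x; apply: leq_height. Qed.

Lemma depth_lt x y : (x < y)%O -> depth x < depth y.
Proof.
move=> lt_xy; have [C [cC leCx <-]] := chain_below_setU1 x.
by apply: leq_depth => // u /leCx le_ux; apply: le_lt_trans lt_xy.
Qed.

End Depth.

Section StrictlyMonotoneMaps.

Variables (d d' : Order.disp_t) (P : finPOrderType d) (Q : finPOrderType d').

(** A longest chain of [Q], transported between [x] and [y], sits on top of a
    longest chain below [x]. *)
Lemma depth_add_height (f : Q -> P) x y :
    {homo f : a b / (a < b)%O} -> (forall a, (x <= f a)%O && (f a < y)%O) ->
    (x <= y)%O ->
  depth x + height Q <= depth y.
Proof.
move=> f_lt f_in le_xy.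
have [C [cC ltCx] <-] := depth_witness x.
have [D /chainP cD <-] := height_witness Q.
have f_inj : {in D &, injective f}.
  move=> a b Da Db eq_f; have := cD a b Da Db.
  by case: comparableP => // /f_lt; rewrite eq_f ltxx.
have cfD : chain (f @: D).
  apply/chainP=> _ _ /imsetP[a Da ->] /imsetP[b Db ->].
  have := cD a b Da Db; case: (comparableP a b) => // [/f_lt le_f|/f_lt le_f|->] _.
  - by apply: le_comparable; apply: ltW.
  - by rewrite comparable_sym; apply: le_comparable; apply: ltW.
  - exact: comparablexx.
have [|cU eqU] := chain_setU cC ltCx cfD.
  by move=> _ /imsetP[a _ ->]; case/andP: (f_in a).
rewrite -(card_in_imset f_inj) -eqU; apply: leq_depth => //.
move=> u /setUP[/ltCx lt_ux|/imsetP[a _ ->]]; first exact: lt_le_trans le_xy.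
by case/andP: (f_in a).
Qed.

End StrictlyMonotoneMaps.

Lemma height_leq_bound d (P : finPOrderType d) (f : P -> nat) m :
  {homo f : x y / (x < y)%O >-> x < y} -> (forall x, f x <= m) -> height P <= m.+1.
Proof.
move=> f_lt f_le; have [C /chainP cC <-] := height_witness P.
have f_inj : {in C &, injective (fun x => inord (f x) : 'I_m.+1)}.
  move=> a b Ca Cb /(congr1 val) /=; rewrite !inordK ?ltnS // => eq_f.
  have := cC a b Ca Cb.
  by case: comparableP => // /f_lt; rewrite eq_f ltnn.
by rewrite -(card_in_imset f_inj) -[X in _ <= X]card_ord max_card.
Qed.

(** * Transformations, their kernels and their codes *)

Section Transformations.

Variable m : nat.
Local Notation n := m.+1.
Local Notation T := {ffun 'I_n -> 'I_n}.
Local Notation "x ** a" := (transf_mul x a) (at level 40, left associativity).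
Implicit Types (x y z a b e : T) (i j : 'I_n).

Definition ker x : {set {set 'I_n}} := preim_partition x [set: 'I_n].

Lemma kerE x y : ker x = ker y <-> forall i j, (x i == x j) = (y i == y j).
Proof.
split=> [eqk i j | eqk].
  have kerb z : (j \in pblock (ker z) i) = (z i == z j).
    rewrite pblock_equivalence_partition ?inE // => u v w _ _ _.
    by split=> // /eqP->.
  by rewrite -!kerb eqk.
apply: eq_in_imset=> i _; apply/setP=> j.
by rewrite !inE eqk.
Qed.

Lemma ker_factor x y : ker x = ker y -> exists a, y = x ** a.
Proof.
move=> /kerE eqk.
exists [ffun p => if [pick i | x i == p] is Some i then y i else p].
apply/ffunP=> i; rewrite !ffunE; case: pickP => [j /eqP eq_x|/(_ i)/eqP//].
by apply/eqP; rewrite -eqk eq_x.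
Qed.

(** The rank is the leading digit and the kernel the last one. So [code]
    separates kernels, and it cannot increase under right multiplication, which
    either keeps the kernel or lowers the rank: it lists the R-classes in an
    order in which every initial segment is a right ideal. *)
Definition code x : nat :=
  #|x @: [set: 'I_n]| * #|{: {set {set 'I_n}}}| + enum_rank (ker x).

Lemma code_inj x y : code x = code y -> ker x = ker y.
Proof.
move=> /(congr1 (modn^~ #|{: {set {set 'I_n}}}|)).
by rewrite !modnMDl !modn_small // => /ord_inj/enum_rank_inj.
Qed.

Lemma code_mul x a : code (x ** a) <= code x.
Proof.
have im_mul : (x ** a) @: setT = a @: (x @: setT).
  by rewrite -imset_comp; apply: eq_imset => i; rewrite /= ffunE.
have [inj_a|] := boolP (#|a @: (x @: setT)| == #|x @: setT|).
  suff -> : code (x ** a) = code x by [].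
  rewrite /code im_mul (eqP inj_a); congr (_ + enum_rank _).
  apply/kerE=> i j; rewrite !ffunE; apply/eqP/eqP=> [|-> //].
  by move/imset_injP: inj_a; apply; apply: imset_f.
rewrite neq_ltn [X in _ || X]ltnNge leq_imset_card orbF => lt_rank.
rewrite /code im_mul; apply: leq_trans (leq_addr _ _).
apply: (@leq_trans ((#|a @: (x @: setT)|).+1 * #|{: {set {set 'I_n}}}|)).
  by rewrite mulSn addnC leq_add2r ltnW.
by rewrite leq_mul2r lt_rank orbT.
Qed.

Lemma code_ker x y : ker x = ker y -> code x = code y.
Proof.
have le_code u v : ker u = ker v -> code v <= code u.
  by case/ker_factor=> a ->; apply: code_mul.
by move=> eqk; apply/eqP; rewrite eqn_leq !le_code.
Qed.

Lemma code_const i x : code [ffun=> i] <= code x.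
Proof.
suff <- : x ** [ffun=> i] = [ffun=> i] by apply: code_mul.
by apply/ffunP=> j; rewrite !ffunE.
Qed.

(** * Normalised transformations and the action of the symmetric group *)

Definition initial_image (r : nat) e : Prop :=
  forall q : nat, q < r <-> exists i, e i = q :> nat.

Definition perm_map r (s : 'S_r) : T :=
  [ffun j : 'I_n => if insub (val j) is Some k then inord (s k) else j].

(** When the image of [e] is the set of the first [r] points, these are the
    elements of the H-class of [e], each obtained once. *)
Definition twist r e (s : 'S_r) : T := e ** perm_map s.

Section Frame.

Variables (r : nat) (e : T).
Hypothesis e_im : initial_image r e.
Implicit Types (s t : 'S_r).

Lemma frame_lt i : e i < r.
Proof. by apply/e_im; exists i. Qed.

Definition frame_ord i : 'I_r := Ordinal (frame_lt i).

Lemma frame_onto (q : 'I_r) : exists i, frame_ord i = q.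
Proof. by have [i eq_i] := (e_im q).1 (ltn_ord q); exists i; apply: val_inj. Qed.

Lemma perm_mapE (s : 'S_r) (q : 'I_r) j : j = q :> nat -> perm_map s j = s q :> nat.
Proof.
move=> eq_j; rewrite ffunE /=; case: insubP => [k _ /= eq_k|]; last first.
  by rewrite eq_j ltn_ord.
have -> : k = q by apply: val_inj; rewrite /= eq_k.
by have [i <-] := frame_onto (s q); rewrite inordK /=.
Qed.

Lemma twistE s i : twist e s i = s (frame_ord i) :> nat.
Proof. by rewrite ffunE; apply: perm_mapE. Qed.

Lemma twist1 : twist e (1%g : 'S_r) = e.
Proof. by apply/ffunP=> i; apply: val_inj; rewrite /= twistE perm1. Qed.

Lemma twist_mul s t : twist e s ** perm_map t = twist e (s * t)%g.
Proof.
apply/ffunP=> i; apply: val_inj; rewrite /= twistE permM ffunE.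
by apply: perm_mapE; apply: twistE.
Qed.

Lemma twist_inj : injective (@twist r e).
Proof.
move=> s t eq_st; apply/permP=> q; have [i <-] := frame_onto q.
by apply: val_inj; rewrite /= -!twistE eq_st.
Qed.

(** Both sides determine the restriction of the right factor to the first [r]
    points. *)
Lemma twist_agree s a b : e ** a = e ** b -> twist e s ** a = twist e s ** b.
Proof.
move=> /ffunP eq_ab; apply/ffunP=> i; rewrite [LHS]ffunE [RHS]ffunE.
have [j eq_j] := frame_onto (s (frame_ord i)).
have -> : twist e s i = e j by apply: val_inj; rewrite /= twistE -eq_j.
by have := eq_ab j; rewrite [LHS]ffunE [RHS]ffunE.
Qed.

Lemma code_twist s : code (twist e s) = code e.
Proof.
apply/eqP; rewrite eqn_leq code_mul /= -{1}twist1 -(mulgV s) -twist_mul.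
exact: code_mul.
Qed.

(** A right factor that keeps the kernel of [e] can be undone on the first [r]
    points, hence keeps the kernel of every twist of [e]. *)
Lemma code_twist_mul s a : code e <= code (e ** a) -> code e <= code (twist e s ** a).
Proof.
move=> le_ea; have eqk : ker (e ** a) = ker e.
  by apply/code_inj/eqP; rewrite eqn_leq code_mul.
have [b eq_e] := ker_factor eqk.
have eq_tw : twist e s ** (a ** b) = twist e s.
  rewrite -[RHS](transf_mulr1) (twist_agree s (b := transf_one n)) //.
  by rewrite transf_mulr1 transf_mulA -eq_e.
by rewrite -(code_twist s) -{1}eq_tw transf_mulA code_mul.
Qed.

Lemma twistP y :
  reflect (exists s : 'S_r, y = twist e s) [exists s : 'S_r, y == twist e s].
Proof. by apply: (iffP existsP) => -[s /eqP]; exists s. Qed.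

(** A map with the kernel of [e] whose values stay below [r] differs from [e] by
    an injective, hence bijective, self-map of the first [r] points. *)
Lemma twist_exists y : ker y = ker e -> (forall i, y i < r) -> exists s : 'S_r, y = twist e s.
Proof.
move=> eqk y_lt.
have [a eq_y] := ker_factor (esym eqk).
have a_lt (q : 'I_r) : a (inord q) < r.
  have [i <-] := frame_onto q.
  have -> : inord (frame_ord i) = e i by apply: val_inj; rewrite /= inordK.
  by have := y_lt i; rewrite eq_y ffunE.
have a_inj : injective (fun q => Ordinal (a_lt q)).
  move=> q1 q2; have [i <-] := frame_onto q1; have [j <-] := frame_onto q2.
  move/(congr1 val) => /= /val_inj eq_a.
  apply: val_inj => /=; congr val; apply/eqP.
  have fE k : inord (e k) = e k :> 'I_n by apply: val_inj; rewrite /= inordK.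
  by rewrite -((kerE y e).1 eqk) eq_y !ffunE -[e i]fE -[e j]fE eq_a.
exists (perm a_inj); apply/ffunP=> i; apply: val_inj; rewrite /= twistE permE /=.
by rewrite eq_y ffunE; congr (val (a _)); apply: val_inj; rewrite /= inordK.
Qed.

End Frame.

(** * Normalised representatives of the kernels *)

Definition rep (K : {set {set 'I_n}}) : T :=
  [ffun i => inord (index (pblock K i) (enum K))].

Section Representative.

Variable K : {set {set 'I_n}}.
Hypothesis partK : partition K [set: 'I_n].

Lemma pblock_part i : pblock K i \in K.
Proof. by rewrite pblock_mem // (cover_partition partK) inE. Qed.

Lemma card_part : 0 < #|K| <= n.
Proof.
apply/andP; split; first by apply/card_gt0P; exists (pblock K ord0); apply: pblock_part.
rewrite -[X in _ <= X]card_ord -cardsT (card_partition partK) -sum1_card.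
apply: leq_sum => A KA; rewrite card_gt0.
by apply: contraTneq KA => ->; case/and3P: partK.
Qed.

Lemma repE i : rep K i = index (pblock K i) (enum K) :> nat.
Proof.
rewrite ffunE inordK //; have /andP[_ le_n] := card_part.
by apply: leq_trans le_n; rewrite [X in _ < X]cardE index_mem mem_enum pblock_part.
Qed.

Lemma rep_initial : initial_image #|K| (rep K).
Proof.
move=> q; split=> [ltq|[i <-]]; last first.
  by rewrite repE cardE index_mem mem_enum pblock_part.
have KA : nth set0 (enum K) q \in K by rewrite -mem_enum mem_nth -?cardE.
have [i Ai] : exists i, i \in nth set0 (enum K) q.
  apply/set0Pn; apply: contraTneq KA => ->; by case/and3P: partK.
exists i; rewrite repE (def_pblock _ KA Ai); last by case/and3P: partK.
by rewrite index_uniq ?enum_uniq -?cardE.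
Qed.

Lemma ker_rep : ker (rep K) = K.
Proof.
rewrite -[RHS](preim_partition_pblock partK); apply: eq_in_imset=> i _.
apply/setP=> j; rewrite !inE; apply/eqP/eqP => [/(congr1 val)/=|eqK].
  rewrite !repE => eq_ix.
  by rewrite -(nth_index set0 (_ : pblock K i \in enum K)) ?mem_enum ?pblock_part //
    eq_ix nth_index // mem_enum pblock_part.
by apply: val_inj; rewrite /= !repE eqK.
Qed.

End Representative.

Lemma partition_ker x : partition (ker x) [set: 'I_n].
Proof. exact: preim_partitionP. Qed.

End Transformations.

(** * Right congruences and their invariants *)

Section RightCongruenceLaws.

Variables (S : finType) (mul : SemiGroup.law S).

Lemma right_congruenceP (R : {set S * S}) :
  reflect [/\ forall x, (x, x) \in R,
              forall x y, (x, y) \in R -> (y, x) \in R,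
              forall x y z, (x, y) \in R -> (y, z) \in R -> (x, z) \in R
            & forall a x y, (x, y) \in R -> (mul x a, mul y a) \in R]
          (right_congruence mul R).
Proof.
apply: (iffP and4P) => [[/forallP R1 R2 R3 R4] | [R1 R2 R3 R4]]; split=> //.
- by move=> x y; apply/implyP; move/forallP: R2 => /(_ x)/forallP.
- move=> x y z Rxy Ryz; move/forallP: R3 => /(_ x)/forallP/(_ y)/forallP/(_ z).
  by rewrite Rxy Ryz.
- move=> a x y; apply/implyP.
  by move/forallP: R4 => /(_ a)/forallP/(_ x)/forallP.
- exact/forallP.
- by apply/forallP=> x; apply/forallP=> y; apply/implyP/R2.
- apply/forallP=> x; apply/forallP=> y; apply/forallP=> z.
  by apply/implyP=> /andP[]; apply: R3.
- apply/forallP=> a; apply/forallP=> x; apply/forallP=> y.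
  exact/implyP/R4.
Qed.

Variable R : rcong mul.

Lemma rcong_refl x : (x, x) \in (R : {set _}).
Proof. by have /right_congruenceP[+ _ _ _] := valP R; apply. Qed.

Lemma rcong_sym x y : (x, y) \in (R : {set _}) -> (y, x) \in (R : {set _}).
Proof. by have /right_congruenceP[_ + _ _] := valP R; apply. Qed.

Lemma rcong_trans x y z :
  (x, y) \in (R : {set _}) -> (y, z) \in (R : {set _}) -> (x, z) \in (R : {set _}).
Proof. by have /right_congruenceP[_ _ + _] := valP R; apply. Qed.

Lemma rcong_mul a x y :
  (x, y) \in (R : {set _}) -> (mul x a, mul y a) \in (R : {set _}).
Proof. by have /right_congruenceP[_ _ _ +] := valP R; apply. Qed.

End RightCongruenceLaws.

Lemma lt_rcong (S : finType) (mul : SemiGroup.law S) (R1 R2 : rcong mul) :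
  (R1 < R2)%O = ((R1 : {set _}) \proper (R2 : {set _})).
Proof. by rewrite lt_leAnge properE. Qed.

Lemma lt_subgroup (gT : finGroupType) (H K : subgroup_lattice gT) :
  (H < K)%O = ((H : {group gT}) \proper (K : {group gT})).
Proof. by rewrite lt_leAnge properE. Qed.

Section Invariants.

Variable m : nat.
Local Notation n := m.+1.
Local Notation T := {ffun 'I_n -> 'I_n}.
Local Notation "x ** a" := (transf_mul x a) (at level 40, left associativity).
Local Notation RC := (rcong (@transf_mul n)).
Implicit Types (x y z a b e : T) (i j : 'I_n) (R : RC).

Definition stab_set (r : nat) (e : T) R : {set 'S_r} :=
  [set s | (e, twist e s) \in (R : {set _})].

(** Closure under products is where the right action matters: if [R] relates
    [e] to [twist e s] and to [twist e t], then multiplying the first pair by [t]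
    on the right gives [twist e t] and [twist e (s * t)]. *)
Lemma stab_group_set r e R : initial_image r e -> group_set (stab_set r e R).
Proof.
move=> e_im; apply/group_setP; split=> [|s t]; rewrite !inE ?twist1 // ?rcong_refl //.
move=> Rs Rt; apply: rcong_trans Rt _.
by rewrite -(twist_mul e_im); apply: (rcong_mul (perm_map m t) Rs).
Qed.

(** Taking the generated group costs nothing when [stab_set] is a group, and
    makes the definition total. *)
Definition stab (r : nat) (e : T) R : {group 'S_r} := <<stab_set r e R>>%G.

Lemma stabE r e R : initial_image r e -> stab r e R = stab_set r e R :> {set _}.
Proof. by move=> e_im; apply: (gen_set_id (stab_group_set R e_im)). Qed.

(** [R] glues the R-class of [e] to an earlier one, or two of its H-classes
    together. *)
Definition fused (r : nat) (e : T) R : bool :=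
  [exists y, [&& (e, y) \in (R : {set _}), code y <= code e &
                 ~~ [exists s : 'S_r, y == twist e s]]].

Lemma stabS r e R1 R2 : (R1 : {set _}) \subset (R2 : {set _}) ->
  stab r e R1 \subset stab r e R2.
Proof. by move=> sR; apply: genS; apply/subsetP=> s; rewrite !inE; apply: (subsetP sR). Qed.

Lemma fusedS r e R1 R2 : (R1 : {set _}) \subset (R2 : {set _}) ->
  fused r e R1 -> fused r e R2.
Proof.
move=> sR /existsP[y /and3P[Ry le_y ny]]; apply/existsP; exists y.
by rewrite (subsetP sR) ?le_y.
Qed.

(** If [e] and [x] have the same kernel, factors carrying them to one another
    can be chosen so that [b] sends no point outside the image of [x] into the
    image of [e]. Then [b] followed by [a] fixes every point that [b] sends
    into the image of [e]. *)
Lemma frame_inverse r e x : initial_image r e -> ker x = ker e ->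
  exists a b, [/\ x = e ** a, e = x ** b & forall p, b p < r -> a (b p) = p].
Proof.
move=> e_im eqk; have [a eq_x] := ker_factor (esym eqk).
pose b : T := [ffun p => if [pick i | x i == p] is Some i then e i else ord_max].
have bx i : b (x i) = e i.
  rewrite ffunE; case: pickP => [j /eqP eq_j|/(_ i)/eqP//].
  by apply/eqP; rewrite -((kerE x e).1 eqk) eq_j.
exists a, b; split=> // [|p].
  by apply/ffunP=> i; rewrite [RHS]ffunE bx.
rewrite [b p]ffunE; case: pickP => [i /eqP <- _|x'p /= lt_mr].
  by rewrite eq_x ffunE.
(* A value below r at a point outside the image of x forces r = n; then e, and
   with it x, is bijective. *)
have e_onto q : exists i, e i = q.
  have [i eq_i] := (e_im q).1 (leq_trans (ltn_ord q) lt_mr).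
  by exists i; apply: val_inj.
have /image_injP e_inj : #|image e 'I_n| == #|'I_n|.
  by apply/eqP/eq_card=> q; rewrite inE; have [i <-] := e_onto q; apply: codom_f.
have x_inj : injective x.
  by move=> i j /eqP; rewrite ((kerE x e).1 eqk) => /eqP; apply: e_inj.
have /codomP[i eq_p] : p \in codom x by apply: (injF_onto x_inj).
by have := x'p i; rewrite eq_p eqxx.
Qed.



(** The witness of fusion in the R-class of [e] itself has a value outside the
    image of [e]. A factor fixing that image can identify this value with another
    one, which lowers the rank and leads to an earlier R-class, except when there
    is no other value; then the maps are constant and the right action carries the
    pair found to all pairs of constants. *)
Lemma fused_cases r e R : initial_image r e -> fused r e R ->
    (exists2 z, (e, z) \in (R : {set _}) & code z < code e) \/
    [/\ forall i j, e i = e j &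
        forall x y, ker x = ker e -> ker y = ker e -> (x, y) \in (R : {set _})].
Proof.
move=> e_im /existsP[z /and3P[Rez le_z /twistP z_out]].
move: le_z; rewrite leq_eqVlt => /orP[/eqP eq_c|]; last by left; exists z.
have eqk : ker z = ker e by apply: code_inj.
have [i le_zi] : exists i, r <= z i.
  apply/existsP; apply: contra_notT z_out => /existsPn z_lt.
  by apply: twist_exists => // i; have := z_lt i; rewrite -ltnNge.
have [/existsP[j neq_ij]|] := boolP [exists j, z j != z i].
  (* c fixes the image of e and identifies z i with z j, so that e = e c is
     related to z c, a map with a coarser kernel. *)
  left; pose v := if z j < r then z j else ord0.
  pose c : T := [ffun p : 'I_n => if p < r then p else v].
  have ec : e ** c = e by apply/ffunP=> k; rewrite !ffunE frame_lt.
  exists (z ** c); first by rewrite -{1}ec; apply: (rcong_mul c Rez).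
  rewrite ltn_neqAle -eq_c code_mul andbT; apply/negP=> /eqP/code_inj/kerE/(_ i j).
  rewrite [in RHS]eq_sym (negPf neq_ij) !ffunE ltnNge le_zi /v /=.
  by case: ifP; rewrite eqxx.
move=> /existsPn z_const; right.
have {}z_const j : z j = z i by apply/eqP/negPn.
have e_const : forall k j, e k = e j.
  by move=> k j; apply/eqP; rewrite -((kerE z e).1 eqk) !z_const.
split=> // x y eqx eqy.
pose c : T := [ffun p : 'I_n => if p < r then x i else y i].
have -> : x = e ** c.
  apply/ffunP=> j; rewrite !ffunE (frame_lt e_im); apply/eqP.
  by rewrite ((kerE x e).1 eqx) (e_const j i).
have -> : y = z ** c.
  apply/ffunP=> j; rewrite !ffunE z_const ltnNge le_zi; apply/eqP.
  by rewrite ((kerE y e).1 eqy) (e_const j i).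
exact: (rcong_mul c Rez).
Qed.

(** A comparable pair of right congruences is determined by the invariants.
    The proof is by induction on the later of the two R-classes of a pair
    related by [R2]: where the class is fused, [R1] moves the pair to earlier
    R-classes; where it is not, the pair lies in a single H-class. *)
Lemma invariants_reflect R1 R2 :
    (R1 : {set _}) \subset (R2 : {set _}) ->
    (forall K, partition K [set: 'I_n] ->
       fused #|K| (rep K) R2 -> fused #|K| (rep K) R1) ->
    (forall K, partition K [set: 'I_n] -> ~~ fused #|K| (rep K) R2 ->
       stab #|K| (rep K) R2 \subset stab #|K| (rep K) R1) ->
  (R2 : {set _}) \subset (R1 : {set _}).
Proof.
move=> sR12 fusedR stabR.
suff sR k x y : code x < k -> code y < k ->
    (x, y) \in (R2 : {set _}) -> (x, y) \in (R1 : {set _}).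
  apply/subsetP=> -[x y]; apply: (sR (maxn (code x) (code y)).+1).
    by rewrite ltnS leq_maxl.
  by rewrite ltnS leq_maxr.
elim: k x y => // k IHk x y; rewrite !ltnS.
wlog le_yx : x y / code y <= code x => [IH ltx lty Rxy | ltx _ Rxy].
  have [/IH|/ltnW/IH] := leqP (code y) (code x); first exact.
  by move=> IHyx; apply/rcong_sym/IHyx/rcong_sym.
pose K := ker x; have partK : partition K [set: 'I_n] := partition_ker x.
pose e := rep K; pose r := #|K|.
have e_im : initial_image r e := rep_initial partK.
have eqk : ker x = ker e by rewrite ker_rep.
have eqc : code x = code e := code_ker eqk.
have [a [b [eq_x eq_e ab]]] := frame_inverse e_im eqk.
have Rb : (e, y ** b) \in (R2 : {set _}) by rewrite eq_e; apply: (rcong_mul b Rxy).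
have le_yb : code (y ** b) <= code e by rewrite -eqc (leq_trans (code_mul _ _)).
have [R2fused | R2stab] := boolP (fused r e R2); last first.
  have /existsP[s /eqP eq_yb] : [exists s : 'S_r, y ** b == twist e s].
    by apply: contraNT R2stab => ny; apply/existsP; exists (y ** b); rewrite Rb le_yb.
  have eq_y : y = twist e s ** a.
    apply/ffunP=> i; rewrite -eq_yb !ffunE ab //.
    have -> : b (y i) = twist e s i by rewrite -eq_yb !ffunE.
    by rewrite twistE.
  rewrite {1}eq_x eq_y; apply: (rcong_mul a).
  have /subsetP/(_ s) := stabR K partK R2stab.
  by rewrite !stabE // !inE; apply; rewrite -eq_yb.
have [[z Rez lt_z]|[e_const R1e]] := fused_cases e_im (fusedR K partK R2fused).
  have R1a c : (e ** c, z ** c) \in (R1 : {set _}) := rcong_mul c Rez.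
  have lt_zc c : code (z ** c) < k.
    by apply: leq_ltn_trans (code_mul _ _) (leq_trans lt_z _); rewrite -eqc.
  have R1x : (x, z ** a) \in (R1 : {set _}) by rewrite {1}eq_x.
  have [w R1y lt_w] : exists2 w, (y, w) \in (R1 : {set _}) & code w < k.
    have [lt_yx|le_xy] := ltnP (code y) (code x).
      by exists y; [apply: rcong_refl | apply: leq_trans ltx].
    have [c ->] : exists c, y = e ** c.
      apply: ker_factor; rewrite -eqk; apply: code_inj.
      by apply/eqP; rewrite eqn_leq le_xy le_yx.
    by exists (z ** c).
  apply: (rcong_trans R1x (rcong_trans _ (rcong_sym R1y))).
  apply: IHk => //; apply: (@rcong_trans _ _ R2 _ x _); last first.
    exact: (rcong_trans Rxy (subsetP sR12 _ R1y)).
  exact: (rcong_sym (subsetP sR12 _ R1x)).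
apply: R1e => //; rewrite -eqk; apply: code_inj; apply/eqP.
rewrite eqn_leq le_yx (_ : x = [ffun=> x ord0]) ?code_const //.
by apply/ffunP=> i; rewrite eq_x [RHS]ffunE [LHS]ffunE [RHS]ffunE (e_const i ord0).
Qed.

(** * The upper bound *)

(** The value at a fused class exceeds all depths, so that a class becoming fused
    counts as one more step above the longest chain of subgroups. *)
Definition weight (K : {set {set 'I_n}}) R : nat :=
  if fused #|K| (rep K) R then height (subgroup_lattice 'S_#|K|)
  else depth (stab #|K| (rep K) R : subgroup_lattice 'S_#|K|).

Lemma weight_bound K R : weight K R <= height (subgroup_lattice 'S_#|K|).
Proof. by rewrite /weight; case: ifP => // _; apply/ltnW/depth_lt_height. Qed.

Lemma leq_depth_subgroup (gT : finGroupType) (H1 H2 : {group gT}) :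
    H1 \subset H2 ->
  depth (H1 : subgroup_lattice gT) <= depth (H2 : subgroup_lattice gT)
    ?= iff (H2 \subset H1).
Proof.
move=> sH; have [sH21|nsH21] := boolP (H2 \subset H1).
  suff -> : H1 = H2 by split; rewrite ?eqxx.
  by apply/val_inj/eqP; rewrite eqEsubset sH.
have lt_d : depth (H1 : subgroup_lattice gT) < depth (H2 : subgroup_lattice gT).
  by apply: depth_lt; rewrite lt_subgroup properE sH.
by split; [apply: ltnW | rewrite ltn_eqF].
Qed.

Lemma weight_mono K R1 R2 :
  (R1 : {set _}) \subset (R2 : {set _}) -> weight K R1 <= weight K R2.
Proof.
move=> sR; rewrite {2}/weight; case: ifP => [_|nf2]; first exact: weight_bound.
rewrite /weight (contraFF (fusedS sR) nf2).
exact/leq_depth_subgroup/stabS.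
Qed.

(** Equal weights mean equal traces: the depths of two comparable subgroups are
    equal only when the subgroups are. *)
Lemma weight_eq K R1 R2 :
    (R1 : {set _}) \subset (R2 : {set _}) -> weight K R2 <= weight K R1 ->
  (fused #|K| (rep K) R2 -> fused #|K| (rep K) R1) /\
  (~~ fused #|K| (rep K) R2 ->
     stab #|K| (rep K) R2 \subset stab #|K| (rep K) R1).
Proof.
move=> sR; rewrite /weight; case: ifP => [_|/(contraFF (fusedS sR))-> le_w].
  by case: ifP => // _; rewrite leqNgt depth_lt_height.
split=> // _; have sS := stabS #|K| (rep K) sR.
by rewrite -(leq_depth_subgroup sS) eqn_leq le_w (leq_depth_subgroup sS).
Qed.

Lemma height_upper :
  height RC <=
    (\sum_(K : {set {set 'I_n}} | partition K [set: 'I_n])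
       height (subgroup_lattice 'S_#|K|)).+1.
Proof.
pose w R := \sum_(K : {set {set 'I_n}} | partition K [set: 'I_n]) weight K R.
apply: (@height_leq_bound _ RC w) => [R1 R2|R]; last first.
  by apply: leq_sum => K _; apply: weight_bound.
rewrite lt_rcong properE => /andP[sR nsR].
rewrite ltnNge; apply: contra nsR => le_w.
have eq_w K : partition K [set: 'I_n] -> weight K R2 <= weight K R1.
  move=> partK; rewrite leqNgt; apply/negP=> lt_K.
  move: le_w; rewrite leqNgt => /negP; apply.
  rewrite /w (bigD1 K) //= [X in _ < X](bigD1 K) //= -addSn leq_add //.
  by apply: leq_sum => L _; apply: weight_mono.
apply: invariants_reflect => // K /eq_w le_K.
  by case: (weight_eq sR le_K).
by case: (weight_eq sR le_K).
Qed.

End Invariants.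

(** * The lower bound *)

Section LongChain.

Variable m : nat.
Local Notation n := m.+1.
Local Notation T := {ffun 'I_n -> 'I_n}.
Local Notation "x ** a" := (transf_mul x a) (at level 40, left associativity).
Local Notation RC := (rcong (@transf_mul n)).
Implicit Types (x y z a b e : T) (i j : 'I_n).

Definition rees_set k : {set T * T} :=
  [set p | (p.1 == p.2) || (code p.1 < k) && (code p.2 < k)].

Lemma rees_right_congruence k : right_congruence (@transf_mul n) (rees_set k).
Proof.
apply/right_congruenceP; split=> [x|x y|x y z|a x y]; rewrite !inE /= ?eqxx //.
- by rewrite eq_sym andbC.
- case/predU1P=> [-> //|/andP[ltx lty]] /predU1P[<-|/andP[_ ltz]].
    by rewrite ltx lty orbT.
  by rewrite ltx ltz orbT.
- case/predU1P=> [->|/andP[ltx lty]]; first by rewrite eqxx.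
  by rewrite !(leq_ltn_trans (code_mul _ _)) ?orbT.
Qed.

(** The Rees congruence of the right ideal formed by the first R-classes. *)
Definition rees k : RC := RCong (rees_right_congruence k).

Lemma rees_sub k : (rees k <= rees k.+1)%O.
Proof.
apply/subsetP=> -[x y]; rewrite !inE /= => /orP[->//|/andP[ltx lty]].
by rewrite !ltnS (ltnW ltx) (ltnW lty) orbT.
Qed.

Section AboveRees.

Variables (r : nat) (e : T).
Hypothesis e_im : initial_image r e.
Implicit Types (H : {group 'S_r}) (s t : 'S_r).

Definition orbit_rel H x y : bool :=
  [exists a, [exists s in H, (x == e ** a) && (y == twist e s ** a)]].

Lemma orbit_relP H x y :
  reflect (exists a s, [/\ s \in H, x = e ** a & y = twist e s ** a])
          (orbit_rel H x y).
Proof.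
apply: (iffP existsP) => [[a /exists_inP[s Hs /andP[/eqP-> /eqP->]]]|].
  by exists a, s.
by case=> a [s [Hs -> ->]]; exists a; apply/exists_inP; exists s; rewrite ?eqxx.
Qed.

(** The right factor absorbs the permutation, which is why pairs with first
    component [e ** a] are enough. *)
Lemma orbit_rel_sym H x y : orbit_rel H x y -> orbit_rel H y x.
Proof.
case/orbit_relP=> a [s [Hs -> ->]]; apply/orbit_relP.
exists (perm_map m s ** a), s^-1%g; rewrite groupV Hs !transf_mulA.
by rewrite twist_mul // mulVg twist1.
Qed.

Lemma orbit_rel_trans H x y z : orbit_rel H x y -> orbit_rel H y z -> orbit_rel H x z.
Proof.
case/orbit_relP=> a [s [Hs -> ->]] /orbit_relP[b [t [Ht eq_sb ->]]].
apply/orbit_relP; exists a, (t * s)%g; split; rewrite ?groupM //.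
rewrite -(twist_mul e_im) -transf_mulA; apply: (twist_agree e_im).
by rewrite -eq_sb transf_mulA.
Qed.

(** As [e] and its twists have the same image, the same right factors move them
    to earlier R-classes; so [orbit_rel] is compatible with collapsing the ideal
    of the elements before [e]. *)
Lemma orbit_rel_code H x y : orbit_rel H x y -> code x < code e -> code y < code e.
Proof.
move/orbit_rel_sym/orbit_relP=> [a [s [_ -> ->]]].
by apply: contraTT; rewrite -!leqNgt; apply: code_twist_mul.
Qed.

Definition orbit_set H : {set T * T} :=
  [set p | [|| p.1 == p.2, (code p.1 < code e) && (code p.2 < code e)
             | orbit_rel H p.1 p.2]].

Lemma orbit_right_congruence H : right_congruence (@transf_mul n) (orbit_set H).
Proof.
have orbC x y : orbit_rel H x y -> (code x < code e) = (code y < code e).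
  move=> xy; apply/idP/idP; first exact: orbit_rel_code xy.
  exact: orbit_rel_code (orbit_rel_sym xy).
apply/right_congruenceP; split=> [x|x y|x y z|a x y]; rewrite !inE /= ?eqxx //.
- by case/or3P=> [/eqP->|/andP[-> ->]|/orbit_rel_sym->]; rewrite ?eqxx ?orbT.
- case/or3P=> [/eqP->//|/andP[ltx lty]|xy] /or3P[/eqP<-|/andP[lty' ltz]|yz].
  + by rewrite ltx lty orbT.
  + by rewrite ltx ltz orbT.
  + by rewrite ltx -(orbC _ _ yz) lty orbT.
  + by rewrite xy !orbT.
  + by rewrite (orbC _ _ xy) lty' ltz orbT.
  + by rewrite (orbit_rel_trans xy yz) !orbT.
- case/or3P=> [/eqP->|/andP[ltx lty]|/orbit_relP[b [s [Hs -> ->]]]].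
  + by rewrite eqxx.
  + by rewrite !(leq_ltn_trans (code_mul _ _)) ?orbT.
  + rewrite -!transf_mulA; apply/or3P/Or33/orbit_relP.
    by exists (b ** a), s; rewrite /twist -!transf_mulA.
Qed.

(** The ideal of the elements before [e] is collapsed, and on the R-class of
    [e] the classes are the orbits of [H]. *)
Definition orbit_cong (H : subgroup_lattice 'S_r) : RC :=
  RCong (orbit_right_congruence H).

(** The pairs starting with [e] recover the subgroup. *)
Lemma orbit_cong_frame H y :
  ((e, y) \in (orbit_cong H : {set _})) = [exists s in H, y == twist e s].
Proof.
rewrite inE /= ltnn /=; apply/idP/exists_inP => [|[s Hs /eqP->]]; last first.
  apply/orP; right; apply/orbit_relP; exists (transf_one n), s.
  by rewrite !transf_mulr1.
case/predU1P=> [<-|/orbit_relP[a [s [Hs eq_e ->]]]].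
  by exists 1%g; rewrite ?group1 ?twist1.
exists s => //; apply/eqP; rewrite -[RHS]transf_mulr1.
by apply: (twist_agree e_im); rewrite -eq_e transf_mulr1.
Qed.

Lemma orbit_cong_lt : {homo orbit_cong : H1 H2 / (H1 < H2)%O}.
Proof.
move=> H1 H2; rewrite lt_subgroup lt_rcong => /properP[/subsetP sH [s H2s nH1s]].
apply/properP; split; [apply/subsetP=> -[x y] | exists (e, twist e s)].
- rewrite !inE /= => /or3P[->//|->|/orbit_relP[a [t [Ht -> ->]]]]; rewrite ?orbT //.
  by apply/or3P/Or33/orbit_relP; exists a, t; split=> //; apply: sH.
- by rewrite orbit_cong_frame; apply/exists_inP; exists s.
- rewrite orbit_cong_frame; apply/exists_inP=> -[t Ht /eqP/(twist_inj e_im) eq_s].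
  by rewrite eq_s Ht in nH1s.
Qed.

Lemma rees_le_orbit_cong H : (rees (code e) <= orbit_cong H)%O.
Proof.
by apply/subsetP=> -[x y]; rewrite !inE /= => /orP[->|->]; rewrite ?orbT.
Qed.

(** The constant map onto the last point separates the two congruences: every
    twist of [e] takes the value 0, and a second point makes this map avoid it. *)
Lemma orbit_cong_lt_rees (m_gt0 : 0 < m) H : (orbit_cong H < rees (code e).+1)%O.
Proof.
rewrite lt_rcong; apply/properP; split.
  apply/subsetP=> -[x y]; rewrite !inE /= => /or3P[->//|/andP[ltx lty]|].
    by rewrite !ltnS (ltnW ltx) (ltnW lty) orbT.
  case/orbit_relP=> a [s [_ -> ->]].
  by rewrite !ltnS code_mul /= -(code_twist e_im s) code_mul orbT.
exists (e, [ffun=> ord_max]); first by rewrite inE /= !ltnS leqnn code_const orbT.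
rewrite orbit_cong_frame; apply/exists_inP=> -[s _ /eqP eq_s].
have r_gt0 : 0 < r := leq_ltn_trans (leq0n _) (frame_lt e_im ord0).
have [i eq_i] := frame_onto e_im ((s^-1)%g (Ordinal r_gt0)).
have := twistE e_im s i; rewrite -eq_s ffunE eq_i permKV /= => eq_m.
by rewrite eq_m in m_gt0.
Qed.

End AboveRees.

(** Each R-class of rank [r] inserts a copy of a longest chain of subgroups of
    'S_r between two consecutive Rees congruences. *)
Lemma depth_rees k : 0 < m ->
  \sum_(K : {set {set 'I_n}} | partition K [set: 'I_n] && (code (rep K) < k))
     height (subgroup_lattice 'S_#|K|) <= depth (rees k).
Proof.
move=> m_gt0; elim: k => [|k IHk].
  by rewrite big_pred0 // => K; rewrite ltn0 andbF.
have [/exists_inP[K partK /eqP eq_k] | noK] :=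
    boolP [exists (K : {set {set 'I_n}} | partition K setT), code (rep K) == k].
  rewrite (bigD1 K) ?partK ?eq_k ?leqnn //= addnC.
  apply: leq_trans (_ : depth (rees k) + height (subgroup_lattice 'S_#|K|) <= _).
    rewrite leq_add2r; apply: leq_trans IHk; apply/eq_leq/eq_bigl=> L.
    case: (boolP (partition L _)) => //= partL; rewrite ltnS leq_eqVlt -eq_k.
    have [->|neq_L] := eqVneq L K; first by rewrite ltnn andbF.
    suff /negPf-> : code (rep L) != code (rep K) by rewrite andbT.
    apply: contraNneq neq_L => /code_inj; rewrite !ker_rep // => ->; exact: eqxx.
  rewrite -eq_k; have e_im := rep_initial partK.
  apply: (depth_add_height (orbit_cong_lt e_im)) (rees_sub _) => H.
  by rewrite rees_le_orbit_cong orbit_cong_lt_rees.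
apply: leq_trans (leq_trans IHk _); last first.
  by have := rees_sub k; rewrite le_eqVlt => /predU1P[<-//|/depth_lt/ltnW].
apply/eq_leq/eq_bigl=> K; case: (boolP (partition K _)) => //= partK.
rewrite ltnS leq_eqVlt; case: eqP => // eq_k.
by case/exists_inP: noK; exists K; rewrite ?eq_k.
Qed.

Lemma height_lower : 0 < m ->
  (\sum_(K : {set {set 'I_n}} | partition K [set: 'I_n])
     height (subgroup_lattice 'S_#|K|)).+1 <= height RC.
Proof.
move=> m_gt0; pose k := (\max_(K : {set {set 'I_n}}) code (rep K)).+1.
apply: leq_ltn_trans (depth_lt_height (rees k)).
apply: leq_trans (depth_rees k m_gt0); apply/eq_leq/eq_bigl=> K.
by rewrite ltnS (@leq_bigmax _ (fun K => code (rep K))) andbT.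
Qed.

End LongChain.

(** * The height formula *)

Lemma sum_partition_card n (f : nat -> nat) : 0 < n ->
  \sum_(P : {set {set 'I_n}} | partition P [set: 'I_n]) f #|P| =
    \sum_(1 <= r < n.+1) stirling2 n r * f r.
Proof.
case: n => // m _.
rewrite big_add1 /= big_mkord.
rewrite (partition_big
  (fun P : {set {set 'I_m.+1}} => inord #|P|.-1 : 'I_m.+1) predT) //=.
apply: eq_bigr => r _; rewrite -sum_nat_const; apply: congr_big => // P.
  rewrite inE; case: (boolP (partition P _)) => //= partP.
  have /andP[P_gt0 leP] := card_part partP.
  by rewrite -val_eqE /= inordK ?prednK // -(eqn_add2r 1) !addn1 prednK.
case/andP=> partP /eqP/(congr1 val) /=.
have /andP[P_gt0 leP] := card_part partP.
by rewrite inordK ?prednK // => <-; rewrite prednK.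
Qed.

Theorem theorem1p4 (n : nat) (hn : 2 <= n) :
  height (rcong (@transf_mul n)) =
    1 + \sum_(1 <= r < n.+1) stirling2 n r * height (subgroup_lattice 'S_r).
Proof.
rewrite -sum_partition_card; last exact: ltnW.
case: n hn => // m m_gt0; apply/eqP; rewrite add1n eqn_leq.
by rewrite height_upper height_lower.
Qed.
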